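(* Let $(\Gamma,h)$, $h\colon\Gamma\to N_{\mathbb R}\cong\mathbb R^n$, be a tropical curve of genus one satisfying Assumption A, with no vertices outside the loop and with $h(\Gamma)$ not contained in a proper affine subspace, and let $r,\,n_n,\,\mathcal H_i,\,\overline G,\,P,\,H$ be as defined in the context. When $n_n=n-r$, the number of elements $(\zeta_{v_i,q})$ of $\prod_{i=1}^k\mathcal H_i$ satisfying $$\prod_{i=1}^k\prod_{q=3}^{m_i-1}\zeta_{v_i,q}^{\,w_{v_i,q}\,g_j(u_{v_i,q})}=1\qquad\text{for all } j=r+1,\dots,n$$ is equal to the number of integral points in $P\setminus\overline G(H)$.
   Context: **Tropical curves.** $N$ is a free abelian group of rank $n$, $N_K=N\otimes_{\mathbb Z}K$. $\Gamma$ is the complement of the set of 1-valent vertices in a connected finite graph with positive integer edge weights; non-compact edges are unbounded. A tropical curve is a proper continuous map $h\colon\Gamma\to N_{\mathbb R}$ such that each edge is either contracted to a point or mapped homeomorphically onto a subset of an affine line of rational slope; vertices map into $N_{\mathbb Q}$; and for each image $p$ of a vertex and each connected component $\Gamma_1$ of $h^{-1}(p)$, the weighted sum of the primitive integral outgoing directions of the edges outside $\Gamma_1$ emanating from $\Gamma_1$ is zero. Genus: first Betti number. Assumption A: (i) all vertices of $\Gamma$ have valence at most 3; (ii) $h$ may contract bounded edges but does not contract a loop to a point; (iii) $(\Gamma,h)$ is a limit of tropical curves with domain $\Gamma$ of a fixed combinatorial type all of whose edges are embedded; (iv) inverse images of vertices of $h(\Gamma)$ are disjoint unions of closed subgraphs.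 $\Gamma^c$ is the graph obtained from $\Gamma$ by contracting all edges contracted by $h$; vertices, edges and the loop below are those of $\Gamma^c$. **Construction.** Let $A$ be the minimal affine subspace of $N_{\mathbb R}$ containing the image of the loop, $\bar A$ the parallel linear subspace, $r=\dim A$. Let $v_1,\dots,v_k$ be the vertices on the loop, in cyclic order. Let $E_{v_i,1},E_{v_i,2}$ be the two loop edges at $v_i$, and let $E_{v_i,q}$ ($q\ge3$) be the other edges at $v_i$, with primitive integral outgoing direction $u_{v_i,q}\in N$ and weight $w_{v_i,q}$, numbered so that $E_{v_i,3},\dots,E_{v_i,m_i}$ are those not contained in $A$ ($m_i=3$ when there are none; otherwise $m_i\ge4$ by balancing). Put $\mathcal E=\{E_{v_i,q}: 1\le i\le k,\ 3\le q\le m_i-1\}$ and $n_n=\sum_{i=1}^k(m_i-3)$, the number of elements of $\mathcal E$. Define $$\mathcal H_i=\{(\zeta_{v_i,q})_{3\le q\le m_i-1}\in(\mathbb C^* )^{m_i-3}: \zeta_{v_i,q}\ne1\ \forall q,\ \zeta_{v_i,q_1}\ne\zeta_{v_i,q_2}\ \forall q_1\ne q_2\}.$$ Assume $n_n=n-r$. Starting from $A_r=A$ and successively adding edges of $\mathcal E$, let $A_r\subset A_{r+1}\subset\dots\subset A_n=N_{\mathbb R}$ be a flag of affine subspaces, each $A_{r+s+1}$ being the minimal affine subspace containing $A_{r+s}$ and an edge of $\mathcal E$ not contained in $A_{r+s}$. Let $\{g_{r+1},\dots,g_n\}$ be a basis of $N^\vee\cap\bar A^\perp$ such that $\{g_{n-s+1},\dots,g_n\}$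 is a basis of the annihilator in $N^\vee$ of the linear space parallel to $A_{n-s}$, for each $s$. Order $\mathcal E=\{E_1,\dots,E_{n-r}\}$ so that the first $i_1=m_1-3$ edges are those at $v_1$, the next $i_2=m_2-3$ those at $v_2$, and so on. $\overline G$ is the $(n-r)\times(n-r)$ integer matrix whose $m$-th column is $(w_m\,g_j(u_m))_{j=r+1,\dots,n}$, $u_m$ and $w_m$ being the direction and weight of $E_m$; it is invertible over $\mathbb Q$. $P=\overline G((0,1)^{n-r})\subset\mathbb R^{n-r}$ is the open parallelotope spanned by the columns of $\overline G$. $H\subset\mathbb R^{n-r}$ is the union of the hyperplanes $\{X_a=X_b\}$ over all pairs $a\ne b$ such that $E_a,E_b$ are attached to the same vertex $v_i$. Integral points are points of $\mathbb Z^{n-r}$. *)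

(* Defs.v *)
(* MathComp world (MathComp-Analysis, real-closed). *)
From HB Require Import structures.
From mathcomp Require Import all_boot all_order all_algebra.
From mathcomp Require Import all_classical all_reals all_analysis.
From mathcomp Require Import complex.

Set Implicit Arguments.
Unset Strict Implicit.
Unset Printing Implicit Defensive.

Import Order.TTheory GRing.Theory Num.Theory.
Import numFieldNormedType.Exports.

Local Open Scope classical_set_scope.
Local Open Scope ring_scope.

(** ** Weighted graphs *)

(* Loops and multiple edges are allowed.  The edge [e] is a copy of [0, 1]
   whose endpoints 0 and 1 are glued to [bd e false] and [bd e true]; the choice
   of this orientation carries no meaning.  A flag (e, b) : edge * bool is the
   end [bd e b] of [e]. *)
Record graph := Graph {
  vert : finType;
  edge : finType;
  bd : edge -> bool -> vert;
  wt : edge -> nat }.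

Definition flag (G : graph) := (edge G * bool)%type.

Definition flag_vert (G : graph) (f : flag G) : vert G := bd f.1 f.2.

Definition valence (G : graph) (x : vert G) : nat :=
  #|[pred f : flag G | flag_vert f == x]|.

Definition adjacent (G : graph) : rel (vert G) :=
  fun x y => [exists f : flag G, (bd f.1 f.2 == x) && (bd f.1 (~~ f.2) == y)].

Definition weighted_graph (G : graph) : Prop :=
  [/\ (0 < #|vert G|)%N,
      (forall x y : vert G, connect (@adjacent G) x y) &
      (forall e : edge G, (0 < wt e)%N)].

(* The cellular boundary map C_1 -> C_0, over rat (acting on row vectors). *)
Definition boundary_mx (G : graph) : 'M[rat]_(#|edge G|, #|vert G|) :=
  \matrix_(a, x) ((bd (enum_val a) true == enum_val x)%:R
                  - (bd (enum_val a) false == enum_val x)%:R).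

(* dim H_1.  Removing the 1-valent vertices does not change the homotopy type,
   so this is also the first Betti number of the complement of that set. *)
Definition betti1 (G : graph) : nat := \rank (kermx (boundary_mx G)).

(* A circle subgraph with vertices v_1, ..., v_k in cyclic order; [l i] is the
   edge joining [v i] to its cyclic successor. *)
Definition is_loop (G : graph) (k : nat)
    (v : 'I_k -> vert G) (l : 'I_k -> edge G) : Prop :=
  [/\ (0 < k)%N, injective v, injective l &
      forall i, exists b, bd (l i) b = v i /\ bd (l i) (~~ b) = v (ordS i)].

(** ** The space Gamma and maps Gamma -> N_R
    N = 'rV[int]_n, N_R = 'rV[R]_n, and Gamma is the complement in |G| of the
    1-valent vertices. *)

Definition inner (G : graph) (x : vert G) : bool := valence x != 1%N.

(* The part of the closed edge [e] lying in Gamma, as a subset of [0, 1]. *)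
Definition dom (R : realType) (G : graph) (e : edge G) : set R :=
  [set t | [/\ 0 <= t, t <= 1,
               t = 0 -> inner (bd e false) & t = 1 -> inner (bd e true)]].

(* A map from Gamma to N_R, given on the (inner) vertices and on each edge. *)
Record curve (R : realType) (n : nat) (G : graph) := Curve {
  hv : vert G -> 'rV[R]_n;
  he : edge G -> R -> 'rV[R]_n }.

Section Curves.
Variables (R : realType) (n : nat).
Implicit Type G : graph.

Definition to_NR (u : 'rV[int]_n) : 'rV[R]_n := map_mx intr u.

Definition edge_image G (h : curve R n G) (e : edge G) : set 'rV[R]_n :=
  he h e @` dom e.

Definition curve_image G (h : curve R n G) : set 'rV[R]_n :=
  [set p | exists2 x : vert G, inner x & p = hv h x] `|`
  \bigcup_e edge_image h e.

Definition compatible G (h : curve R n G) : Prop :=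
  forall f : flag G, inner (flag_vert f) -> he h f.1 f.2%:R = hv h (flag_vert f).

(* Gamma is obtained by gluing finitely many sets [dom e] along endpoints, so
   continuity and properness can be tested on each of them. *)
Definition continuous_curve G (h : curve R n G) : Prop :=
  forall e : edge G, {within dom e, continuous (he h e)}.

Definition proper_curve G (h : curve R n G) : Prop :=
  forall (e : edge G) (K : set 'rV[R]_n),
    compact K -> compact (dom e `&` he h e @^-1` K).

Definition contracted G (h : curve R n G) (e : edge G) : Prop :=
  forall s t, dom e s -> dom e t -> he h e s = he h e t.

(* [e] is mapped homeomorphically onto a subset of an affine line of rational
   slope. *)
Definition embedded G (h : curve R n G) (e : edge G) : Prop :=
  (exists g : 'rV[R]_n -> R,
     {within edge_image h e, continuous g} /\
     forall t, dom e t -> g (he h e t) = t) /\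
  (exists (p : 'rV[R]_n) (u : 'rV[int]_n),
     u != 0 /\ edge_image h e `<=` [set q | exists c, q = p + c *: to_NR u]).

Definition primitive (u : 'rV[int]_n) : Prop :=
  forall (d : nat) (u' : 'rV[int]_n), u = u' *+ d -> d = 1%N.

(* [u] is the primitive integral direction of the edge [f.1] going out of its
   end [flag_vert f] (unique if [f.1] is not contracted). *)
Definition outgoing_direction G (h : curve R n G) (f : flag G)
    (u : 'rV[int]_n) : Prop :=
  primitive u /\
  forall t, dom f.1 t ->
    exists2 c : R, 0 <= c & he h f.1 t = hv h (flag_vert f) + c *: to_NR u.

Definition contr_adjacent G (h : curve R n G) : rel (vert G) :=
  fun x y => [exists f : flag G,
    [&& `[< contracted h f.1 >], bd f.1 f.2 == x & bd f.1 (~~ f.2) == y]].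

(* A non-contracted edge is injective, so the connected component of h^{-1}(p)
   containing a vertex x with h(x) = p consists of the vertices joined to x by
   contracted edges, together with these contracted edges. *)
Definition balanced G (h : curve R n G) : Prop :=
  exists2 u : flag G -> 'rV[int]_n,
    (forall f, inner (flag_vert f) -> ~ contracted h f.1 ->
       outgoing_direction h f (u f)) &
    forall x : vert G, inner x ->
      \sum_(f : flag G | ~~ `[< contracted h f.1 >] &&
                         connect (contr_adjacent h) x (flag_vert f))
         u f *+ wt f.1 = 0.

Record tropical_curve G (h : curve R n G) : Prop := TropicalCurve {
  trop_graph : weighted_graph G;
  trop_compatible : compatible h;
  trop_continuous : continuous_curve h;
  trop_proper : proper_curve h;
  trop_edges : forall e : edge G, contracted h e \/ embedded h e;
  trop_rational : forall x : vert G, inner x ->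
    exists q : 'rV[rat]_n, hv h x = map_mx ratr q;
  trop_balanced : balanced h }.

(* The combinatorial type of a curve with domain G and no contracted edges is
   recorded by the outgoing directions [u] of its edges. *)
Definition limit_of_embedded G (h : curve R n G) : Prop :=
  exists (hs : nat -> curve R n G) (u : flag G -> 'rV[int]_n),
    [/\ (forall j, tropical_curve (hs j)),
        (forall j e, embedded (hs j) e),
        (forall j f, inner (flag_vert f) -> outgoing_direction (hs j) f (u f)),
        (forall x, inner x -> (fun j => hv (hs j) x) @ \oo --> hv h x) &
        (forall e t, dom e t -> (fun j => he (hs j) e t) @ \oo --> he h e t)].

(* In the last clause the vertices of h(Gamma) are the images of the vertices
   of Gamma.  A subset of Gamma that contains every closed edge of which it
   contains an interior point is a union of vertices and closed edges. *)
Record assumptionA G (h : curve R n G) : Prop := AssumptionA {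
  asmA_valence : forall x : vert G, (valence x <= 3)%N;
  asmA_loop : forall (k : nat) (v : 'I_k -> vert G) (l : 'I_k -> edge G),
    is_loop v l -> exists i, ~ contracted h (l i);
  asmA_limit : limit_of_embedded h;
  asmA_preimage : forall (x : vert G) (e : edge G) (t : R),
    inner x -> 0 < t < 1 -> he h e t = hv h x ->
    forall s, dom e s -> he h e s = hv h x }.

(** ** The graph Gamma^c *)

(* Its vertices are the classes of vertices of G under contraction, represented
   by canonical representatives ([fingraph.root]); its edges are the edges of G that are
   not contracted. *)
Lemma contr_adjacent_sym G (h : curve R n G) :
  connect_sym (contr_adjacent h).
Proof.
apply: sym_connect_sym => x y.
apply/existsP/existsP => -[[e b] /= /and3P[he0 h1 h2]];
  by exists (e, ~~ b); rewrite /= negbK he0 h1 h2.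
Qed.

Definition contract_class G (h : curve R n G) (x : vert G) :
    {x : vert G | roots (contr_adjacent h) x} :=
  exist _ (fingraph.root (contr_adjacent h) x) (roots_root (contr_adjacent_sym h) x).

Definition contract_graph G (h : curve R n G) : graph :=
  @Graph {x : vert G | roots (contr_adjacent h) x}
         {e : edge G | ~~ `[< contracted h e >]}
         (fun e b => contract_class h (bd (val e) b))
         (fun e => wt (val e)).

Definition contract_curve G (h : curve R n G) : curve R n (contract_graph h) :=
  @Curve R n (contract_graph h)
    (fun x => hv h (val x)) (fun e => he h (val e)).

(** ** Affine subspaces and annihilators *)

Definition is_affine (A : set 'rV[R]_n) : Prop :=
  exists (p : 'rV[R]_n) (U : {vspace 'rV[R]_n}), A = [set x | x - p \in U].

Definition affine_hull (X : set 'rV[R]_n) : set 'rV[R]_n := smallest is_affine X.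

Definition parallel (A : set 'rV[R]_n) : set 'rV[R]_n :=
  [set z | exists x y, [/\ A x, A y & z = x - y]].

Definition affine_dim (A : set 'rV[R]_n) (r : nat) : Prop :=
  exists p (U : {vspace 'rV[R]_n}), A = [set x | x - p \in U] /\ \dim U = r.

(* The dual lattice of N is 'cV[int]_n, with pairing the matrix product. *)
Definition dual_pairing (phi : 'cV[int]_n) (u : 'rV[int]_n) : int :=
  (u *m phi) 0 0.

Definition annihilator (U : set 'rV[R]_n) : set 'cV[int]_n :=
  [set phi | forall x, U x -> x *m map_mx intr phi = 0].

(* The subfamily of [g] indexed by [J] is a Z-basis of S. *)
Definition is_Zbasis (I : finType) (J : pred I) (g : I -> 'cV[int]_n)
    (S : set 'cV[int]_n) : Prop :=
  [/\ forall a, J a -> S (g a),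
      forall phi, S phi -> exists c : I -> int, phi = \sum_(a | J a) c a *: g a &
      forall c : I -> int, \sum_(a | J a) c a *: g a = 0 ->
        forall a, J a -> c a = 0].

(** ** The construction attached to the loop *)

(* For a vertex [v] of the loop with edges in [range l], [E q] for
   3 <= q <= valence v lists the edges at [v] that are not loop edges (as
   flags, so as to remember the end), those not contained in A coming first, up
   to the index [m].  The values E 1 and E 2, reserved for the two loop edges,
   are not used. *)
Definition edge_numbering G (h : curve R n G) (k : nat) (l : 'I_k -> edge G)
    (A : set 'rV[R]_n) (v : vert G) (m : nat) (E : nat -> flag G) : Prop :=
  [/\ (forall q1 q2, (3 <= q1 <= valence v)%N -> (3 <= q2 <= valence v)%N ->
         E q1 = E q2 -> q1 = q2),
      (forall f : flag G,
         (flag_vert f = v /\ forall i, f.1 <> l i) <->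
         exists2 q, (3 <= q <= valence v)%N & E q = f) &
      (m = 3%N /\
       forall q, (3 <= q <= valence v)%N -> edge_image h (E q).1 `<=` A)
      \/
      ((3 <= m <= valence v)%N /\
       forall q, (3 <= q <= valence v)%N ->
         (~ (edge_image h (E q).1 `<=` A) <-> (q <= m)%N))].

End Curves.

(* The indices q = 3, ..., m - 1 are encoded as q - 3 : 'I_(m - 3). *)
Definition qidx (m : nat) (q : 'I_(m - 3)) : nat := (q + 3)%N.

(* n_n, the number of elements of the set of edges E_{v_i,q}, 3 <= q < m_i. *)
Definition num_normal (k : nat) (m : 'I_k -> nat) : nat :=
  (\sum_(i < k) (m i - 3))%N.

(* [tagnat.sig1] and [tagnat.sig2] number the pairs (i, q) lexicographically by
   'I_(num_normal m): first those with i = v_1, then those with i = v_2, ... *)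
Definition pos_vert (k : nat) (m : 'I_k -> nat) (a : 'I_(num_normal m)) : 'I_k :=
  tagnat.sig1 (p_ := fun i => (m i - 3)%N) a.

Definition pos_q (k : nat) (m : 'I_k -> nat) (a : 'I_(num_normal m)) : nat :=
  qidx (tagnat.sig2 (p_ := fun i => (m i - 3)%N) a).

(* [F s], for 0 <= s <= d, is the flag A_r, ..., A_{r+d} = N_R, each term being
   generated by the previous one and one of the sets [X a]. *)
Definition is_flag (R : realType) (n : nat) (I : Type) (X : I -> set 'rV[R]_n)
    (A : set 'rV[R]_n) (d : nat) (F : nat -> set 'rV[R]_n) : Prop :=
  [/\ F 0%N = A, F d = setT &
      forall s, (s < d)%N ->
        exists2 a, ~ (X a `<=` F s) & F s.+1 = affine_hull (F s `|` X a)].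

(* [g j], for j : 'I_(n - r), stands for g_{r+1+j}, so that
   {g_{n-s+1}, ..., g_n} is the subfamily n - r - s <= j, and A_{n-s} is
   F (n - r - s). *)
Definition adapted_basis (R : realType) (n r : nat) (F : nat -> set 'rV[R]_n)
    (g : 'I_(n - r) -> 'cV[int]_n) : Prop :=
  forall s, (s <= n - r)%N ->
    is_Zbasis (fun j : 'I_(n - r) => (n - r - s <= j)%N) g
      (annihilator (parallel (F (n - r - s)%N))).

(* The matrix whose columns are w_a g_j(u_a). *)
Definition Gbar (n d : nat) (N : nat) (g : 'I_d -> 'cV[int]_n)
    (w : 'I_N -> nat) (u : 'I_N -> 'rV[int]_n) : 'M[int]_(d, N) :=
  \matrix_(j, a) ((w a)%:Z * dual_pairing (g j) (u a)).

(* The set H_i, with d = m_i - 3. *)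
Definition Hset (R : realType) (d : nat) : set 'rV[complex R]_d :=
  [set z | (forall q, z 0 q != 0) /\ (forall q, z 0 q != 1) /\
           (forall q1 q2, q1 != q2 -> z 0 q1 != z 0 q2)].

Definition open_cube (R : realType) (N : nat) : set 'cV[R]_N :=
  [set X | forall a, 0 < X a 0 < 1].

Definition integral_points (R : realType) (d : nat) : set 'cV[R]_d :=
  [set Y | forall j, Y j 0 \is a Num.int].

Definition lin_map (R : realType) (d N : nat) (M : 'M[int]_(d, N)) :
    'cV[R]_N -> 'cV[R]_d :=
  fun X => map_mx intr M *m X.

(* The union of the hyperplanes X_a = X_b for a <> b attached to one vertex. *)
Definition diagonals (R : realType) (N : nat) (T : Type) (at_ : 'I_N -> T) :
    set 'cV[R]_N :=
  [set X | exists a b, [/\ a != b, at_ a = at_ b & X a 0 = X b 0]].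

Definition has_card (T : Type) (S : set T) (M : nat) : Prop := (S #= `I_M)%card.

Arguments open_cube R N : clear implicits.
Arguments integral_points R d : clear implicits.
Arguments diagonals R {N T} at_.

(* Main.v *)
(* Parametrise the unit circle by [0, 1) through x |-> exp(2 i pi x).  Taking
   logarithms of absolute values, the equations and the invertibility of Gbar
   force every solution zeta onto the unit circle, so zeta = exp(2 i pi X) for a
   unique X in the half-open cube; then zeta satisfies the equations iff Gbar X
   is integral, zeta_a <> 1 iff X_a <> 0, and the conditions zeta_a <> zeta_b
   say that X lies off H.  Thus X |-> Gbar X is a bijection from the solutions
   onto the integral points of P \ Gbar(H), which are finitely many since P is
   bounded.

   Gbar is invertible because an integer row vector c with c Gbar = 0 yields a
   functional phi = sum_j c_j g_j killing the directions of A and of all edges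
   of E.  These edges start at vertices lying on A, so phi is constant on A and
   on each of them, hence on every term of the flag, hence on N_R; so phi = 0 and
   c = 0. *)
Require Import Defs.
From HB Require Import structures.
From mathcomp Require Import all_boot all_order all_algebra.
From mathcomp Require Import all_classical all_reals all_analysis.
From mathcomp Require Import complex.
From mathcomp Require Import zify lra.

Set Implicit Arguments.
Unset Strict Implicit.
Unset Printing Implicit Defensive.

Import Order.TTheory GRing.Theory Num.Theory.
Import numFieldNormedType.Exports.

Local Open Scope classical_set_scope.
Local Open Scope ring_scope.

(** * The unit circle parametrised by a half-open interval *)

Section UnitCircle.
Variable R : realType.
Implicit Types (x y : R) (z : R[i]).

Definition cis x : R[i] := (cos (pi *+ 2 * x) +i* sin (pi *+ 2 * x))%C.

Lemma cis0 : cis 0 = 1.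
Proof. by rewrite /cis mulr0 cos0 sin0. Qed.

Lemma cisD x y : cis (x + y) = cis x * cis y.
Proof.
rewrite /cis mulrDr cosD sinD; apply/eqP; rewrite eq_complex /= eqxx /=.
by rewrite [X in X == _]addrC.
Qed.

Lemma cis_neq0 x : cis x != 0.
Proof.
apply/eqP => x0; have := cisD x (- x); rewrite subrr cis0 x0 mul0r.
by move/eqP; rewrite oner_eq0.
Qed.

Lemma cisN x : cis (- x) = (cis x)^-1.
Proof.
apply: (mulfI (cis_neq0 x)); rewrite -cisD subrr cis0.
by rewrite divff ?cis_neq0.
Qed.

Lemma cis_sum (I : finType) (F : I -> R) :
  cis (\sum_i F i) = \prod_i cis (F i).
Proof. exact: (big_morph cis cisD cis0). Qed.

Lemma cisMz (p : int) x : cis (p%:~R * x) = cis x ^ p.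
Proof.
have cisMn q : cis (q%:R * x) = cis x ^+ q.
  elim: q => [|q IH]; first by rewrite mul0r cis0 expr0.
  by rewrite -natr1 mulrDl mul1r cisD IH exprSr.
case: p => q; first exact: cisMn.
by rewrite NegzE mulrNz mulNr cisN -exprnN; congr (_^-1); exact: cisMn.
Qed.

Lemma cis1 : cis 1 = 1.
Proof. by rewrite /cis mulr1 cos2pi sin2pi. Qed.

Lemma cis_int x : x \is a Num.int -> cis x = 1.
Proof. by move=> /intrP[p ->]; rewrite -[p%:~R]mulr1 cisMz cis1 exp1rz. Qed.

(** The double angle formula turns the cosine condition into [sin (pi * x) = 0], while the sine is
    positive strictly between 0 and [pi], so [x] cannot be positive. *)
Lemma cis_eq1_itv x : 0 <= x < 1 -> cis x = 1 -> x = 0.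
Proof.
move=> /andP[x0 x1] /eqP; rewrite eq_complex /= => /andP[/eqP c1 _].
have s0 : sin (pi * x) = 0.
  move: c1; rewrite mulrnAl cos_mulr2n cos2sin2 => c1.
  by apply/eqP; rewrite -sqrf_eq0; apply/eqP; lra.
apply/eqP; rewrite eq_le x0 andbT leNgt; apply/negP => xp.
have : 0 < sin (pi * x).
  apply: sin_gt0_pi; rewrite mulr_gt0 ?pi_gt0//=.
  by rewrite gtr_pMr ?pi_gt0.
by rewrite s0 ltxx.
Qed.

Lemma cis_fracpart x :
  0 <= x - (Num.floor x)%:~R < 1 /\ cis (x - (Num.floor x)%:~R) = cis x.
Proof.
split; last by rewrite cisD (@cis_int (- _)) ?mulr1// rpredN intr_int.
have := floor_le x; have := floorD1_gt x; rewrite intrD => ? ?.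
by apply/andP; split; lra.
Qed.

Lemma cis_eq1 x : (cis x = 1) <-> x \is a Num.int.
Proof.
split; last exact: cis_int.
have [/cis_eq1_itv h <-] := cis_fracpart x => /h /eqP.
by rewrite subr_eq0 => /eqP ->; exact: intr_int.
Qed.

Lemma cis_inj x y : 0 <= x < 1 -> 0 <= y < 1 -> cis x = cis y -> x = y.
Proof.
wlog: x y / y <= x => [hw|yx /andP[x0 x1] /andP[y0 y1] exy].
  by case: (leP y x) => [/hw//|/ltW/hw h x01 y01 /esym exy]; rewrite (h y01 x01).
suff /eqP : x - y = 0 by rewrite subr_eq0 => /eqP.
apply: cis_eq1_itv; first by apply/andP; split; lra.
by rewrite cisD cisN exy divff ?cis_neq0.
Qed.

(** [acos] yields an angle in the upper half-plane; a negative imaginary part calls for the opposite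
    angle. The fractional part then brings the parameter into the interval. *)
Lemma cis_surj z : Normc.normc z = 1 -> exists2 x, 0 <= x < 1 & z = cis x.
Proof.
case: z => a b /= n1.
have ab : a ^+ 2 + b ^+ 2 = 1.
  by rewrite -(@sqr_sqrtr _ (_ + _)) ?addr_ge0 ?sqr_ge0// n1 expr1n.
suff [x zx] : exists x, (a +i* b)%C = cis x.
  by have [? ?] := cis_fracpart x; exists (x - (Num.floor x)%:~R); rewrite ?zx.
have a1 : -1 <= a <= 1 by apply/andP; split; nra.
have sb : sin (acos a) = `|b|.
  by rewrite sin_acos// -ab [_ + b ^+ 2]addrC addrK sqrtr_sqr.
have ca : cos (acos a) = a by rewrite acosK.
have pi2 : pi *+ 2 != 0 :> R by rewrite mulrn_eq0 /= gt_eqF ?pi_gt0.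
have [b0|b0] := leP 0 b.
- exists (acos a / (pi *+ 2)); rewrite /cis mulrCA divff// mulr1 ca sb.
  by rewrite ger0_norm.
- exists (- acos a / (pi *+ 2)); rewrite /cis mulrCA divff// mulr1 cosN sinN.
  by rewrite ca sb ltr0_norm// opprK.
Qed.

End UnitCircle.

(** * Absolute values of complex numbers and their logarithms *)

Lemma normc_gt0 (R : rcfType) (z : R[i]) : z != 0 -> 0 < Normc.normc z.
Proof.
move=> z0; rewrite lt_def; apply/andP; split.
  by apply: contra z0 => /eqP/Normc.eq0_normc ->.
by case: z {z0} => a b; exact: sqrtr_ge0.
Qed.

Lemma normcXz (R : rcfType) (z : R[i]) (p : int) :
  Normc.normc (z ^ p) = Normc.normc z ^ p.
Proof.
have normcX q : Normc.normc (z ^+ q) = Normc.normc z ^+ q.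
  elim: q => [|q IH]; first by rewrite !expr0 Normc.normc1.
  by rewrite !exprS Normc.normcM IH.
by case: p => q; [|rewrite NegzE -!exprnN Normc.normcV]; rewrite normcX.
Qed.

Lemma ln_normcXz (R : realType) (z : R[i]) (p : int) : z != 0 ->
  ln (Normc.normc (z ^ p)) = p%:~R * ln (Normc.normc z).
Proof.
move=> /normc_gt0 nz.
rewrite normcXz; case: p => q.
  by rewrite lnXn// mulr_natl.
by rewrite NegzE -exprnN lnV ?posrE ?exprn_gt0// lnXn// mulrNz mulNr mulr_natl.
Qed.

(** * Torus solutions and lattice points for a nonsingular square matrix *)

Section TorusCount.
Variables (R : realType) (d : nat) (T : Type) (M : 'M[int]_d) (at_ : 'I_d -> T).
Hypothesis M_det : \det M != 0.

Let MR : 'M[R]_d := map_mx intr M.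

Lemma map_unitmx : MR \in unitmx.
Proof. by rewrite unitmxE unitfE det_map_mx intr_eq0. Qed.

Lemma lin_map_inj : injective (lin_map M : 'cV[R]_d -> 'cV[R]_d).
Proof.
move=> x y; rewrite /lin_map -/MR => /(congr1 (mulmx (invmx MR))).
by rewrite !mulKmx // map_unitmx.
Qed.

Let X : set 'cV[R]_d :=
  open_cube R d `&` ~` diagonals R at_ `&` lin_map M @^-1` integral_points R d.

(** Injectivity of the linear map keeps the image of a point off the diagonals away from the image
    of the diagonals. *)
Lemma lin_map_X :
  lin_map M @` X =
  integral_points R d `&` (lin_map M @` open_cube R d `\` lin_map M @` diagonals R at_).
Proof.
apply/seteqP; split => [_ [x [[xc xd] xi] <-]|].
  split => //; split; first by exists x.
  by case=> y yd /lin_map_inj yx; apply: xd; rewrite -yx.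
move=> y [yi [[x xc xy]] yd]; exists x => //; split; last by rewrite /preimage /= xy.
by split=> // xd; apply: yd; exists x.
Qed.

Lemma finite_lin_map_X : finite_set (lin_map M @` X).
Proof.
(* Coordinates in the open unit interval make [B] a bound for every coordinate of the image; [f]
   shifts by [B], coding the integers from [-B] to [B] by ['I_(B + B).+1]. *)
pose B : nat := \sum_j \sum_a `|M j a|%N.
pose f (t : {ffun 'I_d -> 'I_(B + B).+1}) : 'cV[R]_d :=
  \col_j ((t j : nat)%:R - B%:R).
apply: (@sub_finite_set _ _ (f @` setT)); last first.
  by apply: finite_image; exact: finite_finset.
move=> _ [x [[xc _] xi] <-].
have bnd j : `|lin_map M x j 0| <= B%:R.
  rewrite /lin_map mxE (le_trans (ler_norm_sum _ _ _))//.
  apply: (@le_trans _ _ (\sum_a (`|M j a|%N)%:R)).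
    apply: ler_sum => a _; rewrite normrM mxE -intr_norm -[leRHS]mulr1.
    have /andP[x0 x1] := xc a.
    by apply: ler_pM => //; rewrite ger0_norm ltW.
  by rewrite -natr_sum ler_nat [leqRHS](bigD1 j)//= leq_addr.
have ex j : exists t : 'I_(B + B).+1, lin_map M x j 0 = t%:R - B%:R.
  have /intrP[p pE] := xi j; have := bnd j; rewrite pE.
  rewrite -intr_norm -[B%:R]/(B%:~R) ler_int => pB.
  have lt_t : (`|(p + B%:Z)%R|%N < (B + B).+1)%N by lia.
  exists (Ordinal lt_t) => /=; rewrite pmulrn -intrB; congr (_%:~R); lia.
have [t tE] := choice ex.
exists [ffun j => t j] => //; apply/colP => j.
by rewrite /f mxE ffunE tE.
Qed.

Let Z : set 'cV[R[i]]_d :=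
  [set z | [/\ forall a, z a 0 != 0, forall a, z a 0 != 1,
               forall a b, a != b -> at_ a = at_ b -> z a 0 != z b 0 &
               forall j, \prod_a z a 0 ^ M j a = 1]].

Let cisv (x : 'cV[R]_d) : 'cV[R[i]]_d := \col_a cis (x a 0).

Lemma prod_cis (x : 'cV[R]_d) j :
  \prod_a cis (x a 0) ^ M j a = cis (lin_map M x j 0).
Proof.
rewrite /lin_map mxE cis_sum; apply: eq_bigr => a _.
by rewrite -cisMz mxE.
Qed.

Lemma torus_solution_norm (z : 'cV[R[i]]_d) :
  (forall a, z a 0 != 0) -> (forall j, \prod_a z a 0 ^ M j a = 1) ->
  forall a, Normc.normc (z a 0) = 1.
Proof.
move=> z0 z1.
have nz a := normc_gt0 (z0 a).
pose L : 'cV[R]_d := \col_a ln (Normc.normc (z a 0)).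
have : lin_map M L = lin_map M 0.
  rewrite /lin_map mulmx0; apply/colP => j; rewrite !mxE.
  have := congr1 (fun z => ln (Normc.normc z)) (z1 j).
  rewrite Normc.normc1 ln1 => ln_eq0.
  (* Positivity is carried through the induction because [lnM] needs positive factors. *)
  have lnprod (s : seq 'I_d) :
    0 < Normc.normc (\prod_(a <- s) z a 0 ^ M j a) /\
    ln (Normc.normc (\prod_(a <- s) z a 0 ^ M j a)) =
      \sum_(a <- s) (MR j a * L a 0).
    elim: s => [|a s [IHp IH]]; first by rewrite !big_nil Normc.normc1 ln1.
    have pa : 0 < Normc.normc (z a 0 ^ M j a) by rewrite normcXz exprz_gt0.
    rewrite !big_cons Normc.normcM mulr_gt0//; split=> //.
    by rewrite lnM ?posrE// IH ln_normcXz// !mxE.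
  by rewrite -[RHS]ln_eq0 (lnprod _).2.
move/lin_map_inj/colP => L0 a; apply: ln_inj; rewrite ?posrE //.
by have := L0 a; rewrite !mxE ln1.
Qed.

(** Solutions have coordinates of absolute value 1, hence parameters in the half-open interval.
    Excluding the value 1 excludes the parameter 0, and injectivity of [cis] matches equal
    coordinates with the diagonals. *)
Lemma cisv_X : cisv @` X = Z.
Proof.
have itv (x : R) : 0 < x < 1 -> 0 <= x < 1 by move=> /andP[/ltW -> ->].
apply/seteqP; split => [_ [x [[xc xd] xi] <-]|z [z0 z1 zd zM]].
  split=> [a|a|a b ab vab|j]; rewrite ?mxE ?cis_neq0//.
  - apply/eqP => /cis_eq1_itv - /(_ (itv _ (xc a))) x0.
    by have := xc a; rewrite x0 ltxx.
  - apply/eqP => /(cis_inj (itv _ (xc a)) (itv _ (xc b))) xab.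
    by apply: xd; exists a, b.
  - rewrite -[RHS](@cis_int R (lin_map M x j 0)) // -prod_cis.
    by apply: eq_bigr => a _; rewrite mxE.
have ex a : exists x : R, 0 <= x < 1 /\ z a 0 = cis x.
  by have [x ? ?] := cis_surj (torus_solution_norm z0 zM a); exists x.
have [x xE] := choice ex.
have zx : cisv (\col_a x a) = z.
  by apply/colP => a; rewrite !mxE; have [_ <-] := xE a.
have zxa a : z a 0 = cis (x a) by have [] := xE a.
exists (\col_a x a) => //; split; [split|].
- move=> a; rewrite mxE; have [/andP[x0 ->] _] := xE a; rewrite andbT lt_def x0 andbT.
  by apply: contra (z1 a); rewrite zxa => /eqP ->; rewrite cis0.
- move=> [a [b [ab vab]]]; rewrite !mxE => xab.
  by have := zd _ _ ab vab; rewrite !zxa xab eqxx.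
- move=> j; apply/cis_eq1; rewrite -prod_cis -[RHS](zM j).
  by apply: eq_bigr => a _; rewrite mxE zxa.
Qed.

Lemma cisv_inj : {in X &, injective cisv}.
Proof.
move=> x y /set_mem[[xc _] _] /set_mem[[yc _] _] /colP exy; apply/colP => a.
have := exy a; rewrite !mxE; apply: cis_inj.
  by have /andP[/ltW -> ->] := xc a.
by have /andP[/ltW -> ->] := yc a.
Qed.

Lemma torus_count : exists K : nat, has_card Z K /\
  has_card (integral_points R d `&`
    (lin_map M @` open_cube R d `\` lin_map M @` diagonals R at_)) K.
Proof.
have [K KE] := finite_lin_map_X; exists K; split; last by rewrite -lin_map_X.
(* Both sets are injective images of [X], one under [cisv] and one under [lin_map M]. *)
rewrite /has_card -cisv_X (card_eql (inj_card_eq cisv_inj)).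
rewrite -(card_eql (inj_card_eq (f := lin_map M) _)); first exact: KE.
by move=> x y _ _; exact: lin_map_inj.
Qed.

End TorusCount.

(** * Loop vertices and contracted edges *)

Lemma loop_vertex_inner (G : graph) k (v : 'I_k -> vert G) (l : 'I_k -> edge G) :
  is_loop v l -> forall i, (1 < valence (v i))%N.
Proof.
move=> [k0 v_inj l_inj lE] i; apply/card_gt1P.
have [b [lb1 lb2]] := lE i; have [b' [_]] := lE (ord_pred i).
rewrite ord_predK => lb2'.
(* For a one-edge loop the two flags at the vertex are the two ends of that edge; otherwise they
   belong to the two distinct neighbouring loop edges. *)
have [Si|Si] := eqVneq (ord_pred i) i.
  have Si' : ordS i = i by rewrite -{1}Si ord_predK.
  exists (l i, b), (l i, ~~ b); rewrite !inE /flag_vert /= lb1 lb2 Si'.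
  by rewrite eqxx xpair_eqE eqxx /=; case: b {lb1 lb2}.
exists (l i, b), (l (ord_pred i), ~~ b'); rewrite !inE /flag_vert /= lb1 lb2' eqxx.
by split=> //; apply: contra Si => /eqP[/l_inj <-].
Qed.

Section Geometry.
Variables (R : realType) (n : nat) (G : graph) (h : curve R n G).
Hypothesis h_tropical : tropical_curve h.

(* Otherwise the preimage of a point would be a non-compact half-open edge,
   contradicting properness. *)
Lemma contracted_end_inner (f : flag G) :
  contracted h f.1 -> inner (flag_vert f).
Proof.
move=> hf; apply: contrapT => nif.
have hlf : dom f.1 (2^-1 : R).
  split; [lra|lra|move=> h0; exfalso; lra|move=> h1; exfalso; lra].
have := trop_proper h_tropical (e := f.1) (@compact_set1 _ (he h f.1 2^-1)).
have -> : dom f.1 `&` he h f.1 @^-1` [set he h f.1 2^-1] = dom f.1.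
  by apply/seteqP; split => [t []//|t dt]; split => //; exact: hf.
move=> /(compact_closed (@Rhausdorff R)) cl.
have : closure (dom f.1) (f.2%:R : R).
  move=> /= U /nbhs_ballP[e /= e0 eU].
  (* The minimum with 1 keeps [t] strictly inside the edge even for a large radius [e]; [t] or
     [1 - t] is then a domain point near the missing end. *)
  pose t : R := Num.min e 1 / 2.
  have [t0 te t1] : [/\ 0 < t, t < e & t < 1].
    by rewrite /t; case: (ltP e 1) => ?; split; lra.
  exists (if f.2 then 1 - t else t); split.
    by case: f.2; split; try lra; move=> ?; exfalso; lra.
  apply: eU; rewrite /ball /=; case: f.2 => /=.
    by rewrite opprB addrCA subrr addr0 gtr0_norm.
  by rewrite sub0r normrN gtr0_norm.
rewrite -(closure_id _).1 // => -[_ _ d0 d1]; apply: nif; rewrite /flag_vert.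
by case: f.2 d0 d1 => [_ d1|d0 _]; [exact: d1|exact: d0].
Qed.

(** Both ends of a contracted edge are inner, so compatibility applies at each of them; the equality
    propagates along a path of such edges. *)
Lemma hv_contr_connect (x y : vert G) :
  connect (contr_adjacent h) x y -> hv h x = hv h y.
Proof.
move=> /connectP[p]; elim: p x => [|z p IH] x /=; first by move=> _ ->.
move=> /andP[/existsP[[e b] /= /and3P[/asboolP he0 /eqP bx /eqP bz]] pz py].
rewrite -(IH z pz py).
have ib c : inner (bd e c) by exact: (@contracted_end_inner (e, c)).
have cE := trop_compatible h_tropical.
have dc (c : bool) : dom e (c%:R : R).
  by split=> [||_|_]; rewrite ?ib ?ler0n ?(ler_nat R _ 1) ?leq_b1.
have hc c : hv h (bd e c) = he h e c%:R by rewrite (cE (e, c)) //; exact: ib.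
by rewrite -bx -bz !hc; exact: he0.
Qed.

(** The point to check is that the original end is inner. A 1-valent end meets no contracted edge,
    so it is alone in its class, and that class would be 1-valent in the contracted graph. *)
Lemma contract_curve_compatible (f : flag (contract_graph h)) :
  inner (flag_vert f) -> 
  he (contract_curve h) f.1 f.2%:R = hv (contract_curve h) (flag_vert f).
Proof.
case: f => e b /= iv.
set x := bd (val e) b.
have -> : hv h (val (contract_class h x)) = hv h x.
  apply/esym/hv_contr_connect; exact: connect_root.
apply: (trop_compatible h_tropical (f := (val e, b))).
apply: contraR iv => /negbNE vx; apply/eqP.
apply: (fintype.eq_card1 (x := (e, b))) => -[e' b'].
rewrite !inE; apply/eqP/eqP => [[/eqP rx]|-> //].
have xy : connect (contr_adjacent h) x (bd (val e') b').
  by rewrite -(root_connect (contr_adjacent_sym h)) eq_sym.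
have yx : bd (val e') b' = x.
  case/connectP: xy => -[|z p] /=; first by move=> _ ->.
  move=> /andP[/existsP[[e0 b0] /and3P[/asboolP he0 /eqP bx _]] _] _.
  by have := contracted_end_inner (f := (e0, b0)) he0; rewrite /flag_vert bx /inner vx.
have /card_le1P := eq_leq (eqP vx) => /(_ (val e, b)).
rewrite inE eqxx => /(_ isT (val e', b')); rewrite !inE /flag_vert yx eqxx.
by move=> /esym/eqP[/val_inj -> ->].
Qed.

End Geometry.

(** * Integral functionals constant along a flag *)

Section Annihilation.
Variables (R : realType) (n : nat).
Implicit Types (phi : 'cV[int]_n) (A : set 'rV[R]_n).

Lemma is_affine_hyperplane (p : 'rV[R]_n) phi :
  is_affine [set x | x *m map_mx intr phi = p *m map_mx intr phi].
Proof.
exists p, (lker (linfun (mulmxr (map_mx intr phi : 'cV[R]_n)))).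
apply/seteqP; split=> x /=; rewrite memv_ker lfunE /= mulmxBl subr_eq0.
  by move=> ->.
by move=> /eqP.
Qed.

(** Level sets of [phi] are affine, so [B] absorbs each successive affine hull and finally the whole
    space. Comparing the values at 0 and at the basis vectors gives zero. *)
Lemma flag_functional_eq0 (I : Type) (X : I -> set 'rV[R]_n) A (d : nat)
    (F : nat -> set 'rV[R]_n) phi (p : 'rV[R]_n) :
  is_flag X A d F ->
  let B := [set x | x *m map_mx intr phi = p *m map_mx intr phi] in
  A `<=` B -> (forall a, X a `<=` B) -> phi = 0.
Proof.
move=> [F0 Fd FS] B AB XB.
have FB s : (s <= d)%N -> F s `<=` B.
  elim: s => [|s IH] sd; first by rewrite F0.
  have [a _ ->] := FS s sd; apply: smallest_sub; first exact: is_affine_hyperplane.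
  by rewrite subUset; split; [exact/IH/ltnW|exact: XB].
have phi0 x : x *m map_mx intr phi = p *m map_mx intr phi.
  by apply: (FB d (leqnn d)); rewrite Fd.
apply/matrixP => i j; rewrite ord1 mxE.
have := phi0 (delta_mx 0 i); rewrite -(phi0 0) mul0mx -rowE.
by move/rowP/(_ 0); rewrite !mxE => /eqP; rewrite intr_eq0 => /eqP.
Qed.

End Annihilation.

(** The two dimensions met in the application, [num_normal m] and [n - r], are only provably equal,
    hence the rectangular form; a trivial left kernel means a nonzero determinant. *)
Lemma torus_count_rect (R : realType) (d N : nat) (T : Type)
    (M : 'M[int]_(d, N)) (at_ : 'I_N -> T) :
  N = d -> (forall c : 'rV[int]_d, c *m M = 0 -> c = 0) ->
  exists K : nat,
    has_card
      [set z : 'cV[R[i]]_N | [/\ forall a, z a 0 != 0, forall a, z a 0 != 1,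
         forall a b, a != b -> at_ a = at_ b -> z a 0 != z b 0 &
         forall j, \prod_a z a 0 ^ M j a = 1]] K /\
    has_card (integral_points R d `&`
      (lin_map M @` open_cube R N `\` lin_map M @` diagonals R at_)) K.
Proof.
move=> eNd; case: _ / eNd in M * => M_free; apply: torus_count.
by apply/det0P => -[c c0 /M_free cE]; rewrite cE eqxx in c0.
Qed.

(** * Passage between a single column and a family of rows indexed by the loop vertices *)

Section Regroup.
Variables (C : Type) (k : nat) (p : 'I_k -> nat).
Let N := (\sum_i p i)%N.

Definition split_col (z : 'cV[C]_N) : forall i, 'rV[C]_(p i) :=
  fun i => \row_q z (tagnat.Rank (p_ := p) i q) 0.

Definition join_rows (z : forall i, 'rV[C]_(p i)) : 'cV[C]_N :=
  \col_a z (tagnat.sig1 a) 0 (tagnat.sig2 a).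

Lemma split_colK : cancel split_col join_rows.
Proof. by move=> z; apply/colP => a; rewrite !mxE tagnat.sig2K. Qed.

(** The type of the second component depends on the first; applying an arbitrary [f] to both avoids
    any transport between these types. *)
Lemma sig_Rank (T : Type) (f : forall i, 'I_(p i) -> T) i (q : 'I_(p i)) :
  let a := tagnat.Rank (p_ := p) i q in f (tagnat.sig1 a) (tagnat.sig2 a) = f i q.
Proof.
move=> a; rewrite -[LHS]/(f (tag (tagnat.sig a)) (tagged (tagnat.sig a))).
by rewrite tagnat.rankK.
Qed.

Lemma join_rowsK : cancel join_rows split_col.
Proof.
move=> z; apply: functional_extensionality_dep => i; apply/rowP => q.
by rewrite !mxE (sig_Rank (fun i q => z i 0 q)).
Qed.

Lemma prod_regroup (S : comNzRingType) (f : forall i, 'I_(p i) -> S) :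
  \prod_(i < k) \prod_(q < p i) f i q =
  \prod_(a < N) f (tagnat.sig1 a) (tagnat.sig2 a).
Proof. by rewrite sig_big_dep (reindex _ tagnat.sig_bij_on). Qed.

End Regroup.

(** * The count attached to the loop *)

Theorem theorem96 (R : realType) (n : nat) (G : graph) (h : curve R n G)
  (h_tropical : tropical_curve h)
  (h_genus : betti1 G = 1%N)
  (h_asmA : assumptionA h)
  (h_full : forall B : set 'rV[R]_n, is_affine B -> curve_image h `<=` B -> B = setT)
  (* the loop of Gamma^c, and no vertices outside it *)
  (k : nat) (v : 'I_k -> vert (contract_graph h)) (l : 'I_k -> edge (contract_graph h))
  (vl_loop : is_loop v l)
  (no_other_vertex : forall x : vert (contract_graph h), inner x -> exists i, x = v i)
  (* A and r *)
  (A : set 'rV[R]_n) (r : nat)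
  (A_def : A = affine_hull (\bigcup_i edge_image (contract_curve h) (l i)))
  (r_def : affine_dim A r)
  (* the edges E_{v_i,q}, their directions, and the numbers m_i *)
  (m : 'I_k -> nat) (E : 'I_k -> nat -> flag (contract_graph h))
  (E_num : forall i, edge_numbering (contract_curve h) l A (v i) (m i) (E i))
  (u : 'I_k -> nat -> 'rV[int]_n)
  (u_def : forall i q, (3 <= q <= valence (v i))%N ->
     outgoing_direction (contract_curve h) (E i q) (u i q))
  (n_n_eq : num_normal m = (n - r)%N)
  (* the flag A_r, ..., A_n and the basis g_{r+1}, ..., g_n *)
  (F : nat -> set 'rV[R]_n)
  (F_flag : is_flag
     (fun a : 'I_(num_normal m) =>
        edge_image (contract_curve h) (E (pos_vert a) (pos_q a)).1) A (n - r) F)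
  (g : 'I_(n - r) -> 'cV[int]_n)
  (g_basis : adapted_basis F g) :
  let w i q := wt (E i q).1 in
  let G_bar := Gbar g (fun a : 'I_(num_normal m) => w (pos_vert a) (pos_q a))
                      (fun a => u (pos_vert a) (pos_q a)) in
  let P := lin_map G_bar @` open_cube R (num_normal m) in
  let H := diagonals R (@pos_vert k m) in
  exists M : nat,
    has_card
      [set z : forall i : 'I_k, 'rV[complex R]_(m i - 3) |
        (forall i, Hset (z i)) /\
        forall j : 'I_(n - r),
          \prod_(i < k) \prod_(q < m i - 3)
            z i 0 q ^ ((w i (qidx q))%:Z * dual_pairing (g j) (u i (qidx q))) = 1]
      M /\
    has_card (integral_points R (n - r) `&` (P `\` lin_map G_bar @` H)) M.
Proof.
move=> w G_bar P H.
(* In the case [m i = 3] the index type at that vertex is empty, so no position arises there. *)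
have pos_range (a : 'I_(num_normal m)) :
  (3 <= pos_q a <= valence (v (pos_vert a)))%N.
  rewrite /pos_q /qidx /pos_vert; set i := tagnat.sig1 a.
  have := ltn_ord (tagnat.sig2 a); rewrite -/i.
  by have [_ _ [[m3 _]|[/andP[m3 mv] _]]] := E_num i; lia.
have hv_A i : A (hv (contract_curve h) (v i)).
  have v1 := loop_vertex_inner vl_loop i.
  have iv : inner (v i) by rewrite /inner gtn_eqF.
  have [_ _ _ /(_ i)[b [lb _]]] := vl_loop.
  rewrite A_def; apply: sub_gen_smallest; exists i => //.
  exists b%:R; last first.
    have := contract_curve_compatible h_tropical (f := (l i, b)).
    by rewrite /flag_vert [bd _ _]lb => /(_ iv).
  split; rewrite ?ler0n ?(ler_nat R _ 1) ?leq_b1 //.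
  - by case: b lb => [_ /eqP|lb _]; [rewrite oner_eq0|rewrite lb].
  - by case: b lb => [lb _|_ /esym/eqP]; [rewrite lb|rewrite oner_eq0].
have G_bar_free (c : 'rV[int]_(n - r)) : c *m G_bar = 0 -> c = 0.
  move=> cG; pose phi : 'cV[int]_n := \sum_j c 0 j *: g j.
  (* The choice [s = n - r] selects the whole family [g] and the first term of the flag, which is
     [A]. *)
  have [g_ann _ g_free] := g_basis _ (leqnn (n - r)).
  have F0 : F (n - r - (n - r))%N = A by rewrite subnn; have [] := F_flag.
  rewrite F0 in g_ann.
  suff phi0 : phi = 0.
    apply/rowP => j; rewrite mxE; apply: (g_free (fun j => c 0 j)).
      rewrite -[RHS]phi0; apply: eq_bigl => a; lia.
    lia.
  have phi_u (a : 'I_(num_normal m)) : u (pos_vert a) (pos_q a) *m phi = 0.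
    apply/matrixP => i j; rewrite !ord1; transitivity (0 : int); last by rewrite mxE.
    have := congr1 (fun B : 'rV_(num_normal m) => B 0 a) cG; rewrite mxE [RHS]mxE.
    under eq_bigr do rewrite mxE mulrCA.
    (* Each entry of [c *m G_bar] is an edge weight times the value of [phi] on the direction; the
       weight is positive and cancels. *)
    rewrite -mulr_sumr => /eqP; rewrite mulf_eq0 eqz_nat gtn_eqF /=; last first.
      by have [_ _] := trop_graph h_tropical; exact.
    move=> /eqP s0; rewrite -[RHS]s0 /phi mulmx_sumr summxE; apply: eq_bigr => b _.
    by rewrite -scalemxAr mxE.
  have [i0] : exists i : 'I_k, True.
    by have [k0 _ _ _] := vl_loop; exists (Ordinal k0).
  move=> _; have A0 := hv_A i0.
  have A_phi x : A x ->
    x *m map_mx intr phi = hv (contract_curve h) (v i0) *m map_mx intr phi.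
    move=> Ax; apply/eqP; rewrite -subr_eq0 -mulmxBl; apply/eqP.
    rewrite /phi raddf_sum mulmx_sumr big1 // => j _ /=.
    rewrite map_mxZ -scalemxAr g_ann ?scaler0 //; first lia.
    by exists x, (hv (contract_curve h) (v i0)).
  apply: (flag_functional_eq0 F_flag A_phi) => a y [t dt ty].
  (* The flag has its end at the loop vertex, so each point of the edge is a point of [A] plus a
     multiple of a direction killed by [phi]. *)
  have [_ /(_ (E (pos_vert a) (pos_q a)))[_ fv] _] := E_num (pos_vert a).
  have {fv} [] := fv; first by exists (pos_q a); first exact: pos_range.
  move=> fv _.
  have [_ /(_ t dt)[b _ tE]] := u_def _ _ (pos_range a).
  rewrite /= -ty tE fv mulmxDl A_phi // -scalemxAl /to_NR -map_mxM phi_u map_mx0.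
  by rewrite scaler0 addr0.
have [K [ZK PK]] := torus_count_rect R (@pos_vert k m) n_n_eq G_bar_free.
exists K; split; last exact: PK.
set Z := (X in has_card X K) in ZK; set S := (X in has_card X K).
have prodE (z : forall i : 'I_k, 'rV[R[i]]_(m i - 3)) j :
    \prod_(a < num_normal m) join_rows z a 0 ^ G_bar j a =
    \prod_(i < k) \prod_(q < m i - 3)
      z i 0 q ^ ((w i (qidx q))%:Z * dual_pairing (g j) (u i (qidx q))).
  by rewrite prod_regroup; apply: eq_bigr => a _; rewrite !mxE.
suff -> : S = @split_col _ k (fun i => m i - 3)%N @` Z.
  rewrite /has_card (card_eql (inj_card_eq _)) // => z1 z2 _ _.
  exact: can_inj (@split_colK _ _ _) _ _.
apply/seteqP; split => [z [z_H z_eq]|_ [z [z0 z1 zd zM] <-]].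
  exists (join_rows z); last exact: join_rowsK.
  split=> [a|a|a b ab vab|j]; rewrite ?mxE ?prodE //.
  - by have [+ _] := z_H (tagnat.sig1 a).
  - by have [_ [+ _]] := z_H (tagnat.sig1 a).
  (* Writing both positions as ranks of pairs turns the equality of vertices into one that can be
     eliminated, after which both entries lie in the same row. *)
  - have rankP c : exists i q, c = tagnat.Rank (p_ := fun i => (m i - 3)%N) i q.
      by exists (tagnat.sig1 c), (tagnat.sig2 c); rewrite tagnat.sig2K.
    have [[i [q aE]] [i' [q' bE]]] := (rankP a, rankP b).
    move: ab vab; rewrite aE bE !(sig_Rank (fun i q => z i 0 q)).
    rewrite /pos_vert !tagnat.Rank1K => qq' ii'.
    case: _ / ii' in q' bE qq' *; have [_ [_]] := z_H i; apply.
    by apply: contra qq' => /eqP ->.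
split=> [i|j].
  split=> [q|]; first by rewrite mxE.
  split=> [q|q1 q2 q12]; rewrite !mxE//.
  apply: zd; last by rewrite /pos_vert !tagnat.Rank1K.
  apply: contra q12 => /eqP /(congr1 val)/eqP.
  by rewrite tagnat.eq_Rank eqxx.
by rewrite -prodE -[RHS](zM j) split_colK.
Qed.
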